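(* Let $\mathbb K$ be a field of characteristic $0$, $\ell\ge2$, and let $(d_{n,k})_{n,k\ge0}=(g;f_1,f_2,\ldots,f_\ell)$ be an $\ell$-multiple Riordan array over $\mathbb K$. Let $A(t)=\sum_{k\ge0}a_kt^{\ell k}$ and $Z_i(t)=\sum_{k\ge0}z_{i,k}t^{\ell k}$, $i=0,1,\ldots,\ell-1$, be the generating functions of its $A$-sequence and its $Z_0$-, $Z_1$-, $\ldots$, $Z_{\ell-1}$-sequences. Then $$A(t)=\frac{t^\ell}{\overline h^{\,\ell}},\qquad Z_0(t)=\frac1{\overline h^{\,\ell}}\left(1-\frac{g_0}{g(\overline h)}\right),$$ and for $m=1,2,\ldots,\ell-1$, $$Z_m(t)=\frac1{\overline h^{\,\ell}}\left(1-\frac{g_0f_{1,1}f_{2,1}\cdots f_{m,1}\,\overline h^{\,m}}{g(\overline h)f_1(\overline h)f_2(\overline h)\cdots f_m(\overline h)}\right),$$ where $\overline h=\overline h(t)$ is the compositional inverse of $h=\sqrt[\ell]{f_1f_2\cdots f_\ell}$, $g_0=[t^0]g$ and $f_{i,1}=[t]f_i$.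
   Context: An $\ell$-multiple Riordan array $(g;f_1,\ldots,f_\ell)$ is given by $g\in\mathbb K[[t^\ell]]$ with $g(0)\neq0$ and $f_i\in t\,\mathbb K[[t^\ell]]$ with $[t]f_i\ne0$ ($i=1,\ldots,\ell$). Its entries are $$d_{n,k}=[t^n]\,g\,f_1^{\lfloor (k+\ell-1)/\ell\rfloor}f_2^{\lfloor (k+\ell-2)/\ell\rfloor}\cdots f_\ell^{\lfloor k/\ell\rfloor},$$ so the successive columns have generating functions $g,gf_1,gf_1f_2,\ldots,gf_1\cdots f_\ell,gf_1^2f_2\cdots f_\ell,\ldots$. The $A$-sequence $(a_0,a_1,\ldots)$ is the unique sequence with $$d_{n,k}=\sum_{j\ge0}a_j\,d_{n-\ell,\,k+(j-1)\ell}\quad\text{for all } n,k\ge\ell.$$ For $m=0,1,\ldots,\ell-1$, the $Z_m$-sequence $(z_{m,0},z_{m,1},\ldots)$ is the unique sequence with $$d_{n,m}=\sum_{j\ge0}z_{m,j}\,d_{n-\ell,\,m+j\ell}\quad\text{for all } n\ge m+1,$$ where entries with negative row index are $0$. All sums are finite since $d_{n,k}=0$ for $k>n$. $h$ is any formal power series with $h^\ell=f_1\cdots f_\ell$ (with coefficients in the algebraic closure of $\mathbb K$ if necessary; it has order $1$, and the right-hand sides do not depend on the choice of $h$), and $\overline h$ satisfies $h(\overline h(t))=\overline h(h(t))=t$. *)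

(* Defs.v *)
(* mathcomp-classical provides decidable equality and choice on nat -> R, and
   finitely supported sums. *)
From HB Require Import structures.
From mathcomp Require Import all_boot all_order all_algebra.
From mathcomp Require Import boolp classical_sets fsbigop.

Set Implicit Arguments.
Unset Strict Implicit.
Unset Printing Implicit Defensive.

Import GRing.Theory.
Local Open Scope ring_scope.

Record fps (R : Type) := Fps { fps_coef :> nat -> R }.

Notation "{ 'fps' R }" := (fps R) (at level 0, format "{ 'fps'  R }").

HB.instance Definition _ (R : Type) := [isNew for @fps_coef R].
HB.instance Definition _ (R : choiceType) := [Choice of {fps R} by <:].

Lemma fpsP (R : Type) (p q : {fps R}) : (forall n, p n = q n) <-> p = q.
Proof.
split=> [|-> //]; case: p q => [p] [q] /= pq.
by congr Fps; apply/funext.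
Qed.

Section FpsZmodule.
Variable R : zmodType.
Implicit Types p q : {fps R}.

Definition fps_zero : {fps R} := Fps (fun=> 0).
Definition fps_opp p : {fps R} := Fps (fun n => - p n).
Definition fps_add p q : {fps R} := Fps (fun n => p n + q n).

Fact fps_addA : associative fps_add.
Proof. by move=> p q r; apply/fpsP => n /=; rewrite addrA. Qed.
Fact fps_addC : commutative fps_add.
Proof. by move=> p q; apply/fpsP => n /=; rewrite addrC. Qed.
Fact fps_add0 : left_id fps_zero fps_add.
Proof. by move=> p; apply/fpsP => n /=; rewrite add0r. Qed.
Fact fps_addN : left_inverse fps_zero fps_opp fps_add.
Proof. by move=> p; apply/fpsP => n /=; rewrite addNr. Qed.

HB.instance Definition _ :=
  GRing.isZmodule.Build {fps R} fps_addA fps_addC fps_add0 fps_addN.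

End FpsZmodule.

Section FpsRing.
Variable R : comNzRingType.
Implicit Types (p q : {fps R}) (c : R).

Definition fpsC c : {fps R} := Fps (fun n => if n == 0%N then c else 0).
Definition fpsX : {fps R} := Fps (fun n => (n == 1%N)%:R).
Definition fps_mul p q : {fps R} :=
  Fps (fun n => \sum_(i < n.+1) p i * q (n - i)%N).

Let trunc N p : {poly R} := \poly_(i < N) p i.

Let fps_mulE N p q n : (n < N)%N ->
  fps_mul p q n = (trunc N p * trunc N q)`_n.
Proof.
move=> nN; rewrite coefM; apply: eq_bigr => i _; rewrite !coef_poly.
by rewrite (leq_ltn_trans (leq_subr _ _) nN) (leq_trans (ltn_ord i) nN).
Qed.

Fact fps_mulC : commutative fps_mul.
Proof. by move=> p q; apply/fpsP => n; rewrite !(fps_mulE (N := n.+1)) // mulrC. Qed.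
Fact fps_mulA : associative fps_mul.
Proof.
move=> p q r; apply/fpsP => n.
transitivity (trunc n.+1 p * (trunc n.+1 q * trunc n.+1 r))`_n.
  rewrite coefM; apply: eq_bigr => i _.
  by rewrite (fps_mulE (N := n.+1)) ?ltnS ?leq_subr // coef_poly ltn_ord.
rewrite mulrA coefM; apply: eq_bigr => i _.
by rewrite (fps_mulE (N := n.+1)) // coef_poly ltnS leq_subr.
Qed.
Fact fps_mul1 : left_id (fpsC 1) fps_mul.
Proof.
move=> p; apply/fpsP => n /=; rewrite big_ord_recl /= mul1r subn0.
by rewrite big1 ?addr0 // => i _; rewrite mul0r.
Qed.
Fact fps_mulDl : left_distributive fps_mul (@fps_add R).
Proof.
move=> p q r; apply/fpsP => n /=; rewrite -big_split.
by apply: eq_bigr => i _; rewrite mulrDl.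
Qed.
Fact fps_oner_neq0 : fpsC 1 != 0.
Proof. by apply/eqP => /fpsP /(_ 0%N) /= /eqP; rewrite oner_eq0. Qed.

HB.instance Definition _ := GRing.Zmodule_isComNzRing.Build {fps R}
  fps_mulA fps_mulC fps_mul1 fps_mulDl fps_oner_neq0.

Definition in_fps_pow (l : nat) (p : {fps R}) : Prop :=
  forall n, ~~ (l %| n)%N -> p n = 0.

(* The composite p(u), meaningful when u 0 = 0: then (u ^+ k) n = 0 for k > n,
   so that stopping the sum at k = n loses nothing. *)
Definition fps_comp p u : {fps R} :=
  Fps (fun n => \sum_(k < n.+1) p k * fps_coef (u ^+ k) n).

Definition comp_inverse (h hbar : {fps R}) : Prop :=
  [/\ h 0%N = 0, hbar 0%N = 0, fps_comp h hbar = fpsX & fps_comp hbar h = fpsX].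

(* sum_k a_k t^(l k) *)
Definition gen_fun (l : nat) (a : nat -> R) : {fps R} :=
  Fps (fun n => if (l %| n)%N then a (n %/ l)%N else 0).

End FpsRing.

Arguments fpsX {R}.

Definition map_fps (R S : Type) (s : R -> S) (p : {fps R}) : {fps S} :=
  Fps (fun n => s (p n)).

(* Over a field, {fps K} is an integral domain, so that {fraction {fps K}}
    (the field of Laurent series) is available. *)
Section FpsField.
Variable K : fieldType.
Implicit Types p q : {fps K}.

(* The first n coefficients of the inverse of p, when p 0 != 0. *)
Fixpoint fps_inv_seq p n : seq K :=
  if n is n'.+1 then
    let s := fps_inv_seq p n' in
    rcons s ((p 0%N)^-1 * ((n' == 0%N)%:R - \sum_(i < n') s`_i * p (n' - i)%N))
  else [::].

Let inv p : {fps K} := Fps (fun n => (fps_inv_seq p n.+1)`_n).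

Let size_inv_seq p n : size (fps_inv_seq p n) = n.
Proof. by elim: n => //= n IH; rewrite size_rcons IH. Qed.

Let nth_inv_seq p n i : (i < n)%N -> (fps_inv_seq p n)`_i = inv p i.
Proof.
elim: n => // n IH; rewrite ltnS leq_eqVlt => /predU1P[-> //|lt_in].
by rewrite /= nth_rcons size_inv_seq lt_in IH.
Qed.

Definition fps_unit : {pred {fps K}} := fun p => p 0%N != 0.
Definition fps_inv p : {fps K} := if fps_unit p then inv p else p.

Fact fps_mulVx : {in fps_unit, left_inverse 1 fps_inv *%R}.
Proof.
move=> p up; rewrite /fps_inv ifT //; apply/fpsP => n.
rewrite [LHS]big_ord_recr /= subnn nth_rcons size_inv_seq ltnn eqxx.
rewrite mulrAC mulVf // mul1r addrC -addrA.
rewrite (eq_bigr (fun i : 'I_n => inv p i * p (n - i)%N)) => [|i _]; last first.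
  by rewrite nth_inv_seq.
by rewrite addNr addr0; case: eqP.
Qed.

Fact fps_unitPl p q : q * p = 1 -> fps_unit p.
Proof.
move=> /fpsP/(_ 0%N) /=; rewrite big_ord1 /= => qp1.
by apply/eqP => p0; move/eqP: qp1; rewrite p0 mulr0 eq_sym oner_eq0.
Qed.

Fact fps_inv_out : {in [predC fps_unit], fps_inv =1 id}.
Proof. by move=> p nup; rewrite /fps_inv; case: ifP => // up; case/negP: nup. Qed.

HB.instance Definition _ := GRing.ComNzRing_hasMulInverse.Build {fps K}
  fps_mulVx fps_unitPl fps_inv_out.

Let fps_lowest p : p != 0 ->
  exists n, p n != 0 /\ forall i, (i < n)%N -> p i = 0.
Proof.
move=> p_neq0.
have ex_n : exists n, p n != 0.
  apply: contra_notP (negP p_neq0) => no_n; apply/eqP/fpsP => n.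
  by apply/eqP; apply: contra_notT no_n => ?; exists n.
exists (ex_minn ex_n); case: ex_minnP => n pn min_n; split=> // i.
by rewrite ltnNge => /negP lt_in; apply/eqP; apply: contra_notT lt_in => /min_n.
Qed.

Fact fps_integral p q : p * q = 0 -> (p == 0) || (q == 0).
Proof.
move=> pq0; apply: contraT; rewrite negb_or => /andP[].
move=> /fps_lowest[m [pm lt_m]] /fps_lowest[n [qn lt_n]].
move/fpsP/(_ (m + n)%N): pq0 => /= /eqP.
have lt_mS : (m < (m + n).+1)%N by rewrite ltnS leq_addr.
rewrite (bigD1 (Ordinal lt_mS)) //= addKn big1 => [|i].
  by rewrite addr0 mulf_eq0 (negPf pm) (negPf qn).
rewrite -val_eqE /= neq_ltn => /orP[lt_im|lt_mi]; first by rewrite lt_m ?mul0r.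
rewrite lt_n ?mulr0 // ltn_subLR; last by rewrite -ltnS.
by rewrite ltn_add2r.
Qed.

HB.instance Definition _ :=
  GRing.ComUnitRing_isIntegral.Build {fps K} fps_integral.

End FpsField.

Notation "x %:F" := (FracField.tofrac x) : ring_scope.

Section MultipleRiordan.
Variable K : fieldType.
Implicit Types (l : nat) (d : nat -> nat -> K).

(* f i is the series f_(i+1) of the usual 1-based numbering. *)
Definition is_multiple_riordan l (g : {fps K}) (f : 'I_l -> {fps K}) : Prop :=
  [/\ in_fps_pow l g, g 0%N != 0 &
      forall i : 'I_l,
        (exists2 u, in_fps_pow l u & f i = fpsX * u) /\ f i 1%N != 0].

Definition riordan_entry l (g : {fps K}) (f : 'I_l -> {fps K}) (n k : nat) : K :=
  fps_coef (g * \prod_(i < l) f i ^+ ((k + l - i.+1) %/ l)%N) n.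

(* The entry d_(n-l,k), which is 0 when the row index n - l is negative. *)
Definition entry_up l d (n k : nat) : K :=
  if (l <= n)%N then d (n - l)%N k else 0.

(* The sums over all of nat below are the finitely supported sums of fsbigop;
   they have finite support for lower triangular d. Since k >= l, the
   truncated k + j * l - l is the exact column index k + (j - 1) l. *)
Definition is_A_sequence l d (a : nat -> K) : Prop :=
  forall n k, (l <= n)%N -> (l <= k)%N ->
    d n k = \sum_(j \in [set: nat]) a j * d (n - l)%N (k + j * l - l)%N.

Definition is_Z_sequence l d (m : nat) (z : nat -> K) : Prop :=
  forall n, (m.+1 <= n)%N ->
    d n m = \sum_(j \in [set: nat]) z j * entry_up l d n (m + j * l)%N.

End MultipleRiordan.

(* Main.v *)
(* Put F = f_1 ... f_l and let G_m = g f_1 ... f_m (m < l) generate column m, so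
   that column m + j l is generated by G_m F^j.  With A0(x) = sum_j a_j x^j and
   Z0_m(x) = sum_j z_(m,j) x^j, the recurrences become the identities
     F = t^l A0(F)   and   G_m = c_m t^m + t^l G_m Z0_m(F),
   where c_m t^m is the lowest term of G_m.  Substituting hbar turns t into hbar
   and F = h^l into t^l, hence A0(F) into A(t) and Z0_m(F) into Z_m(t). *)
Require Import Defs.
From mathcomp Require Import all_boot all_order all_algebra.
From HB Require Import structures.
From mathcomp Require Import boolp classical_sets fsbigop.

Set Implicit Arguments.
Unset Strict Implicit.
Unset Printing Implicit Defensive.

Import GRing.Theory.
Local Open Scope ring_scope.

(** * Coefficients of products and powers of formal power series *)

Section FpsCoefficients.
Variable R : comNzRingType.
Implicit Types (p q u : {fps R}) (c : R).

Lemma coef_fpsM p q n : fps_coef (p * q) n = \sum_(i < n.+1) p i * q (n - i)%N.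
Proof. by []. Qed.

Lemma coef_fpsM0 p q : fps_coef (p * q) 0%N = p 0%N * q 0%N.
Proof. by rewrite coef_fpsM big_ord1. Qed.

Lemma coef_fps_sum (I : Type) (r : seq I) (P : pred I) (F : I -> {fps R}) n :
  fps_coef (\sum_(i <- r | P i) F i) n = \sum_(i <- r | P i) F i n.
Proof. by apply: (big_morph (fun p : {fps R} => p n)). Qed.

Lemma coef_fpsCM c p n : fps_coef (fpsC c * p) n = c * p n.
Proof.
rewrite coef_fpsM big_ord_recl /= subn0 big1 => [|i _]; last by rewrite mul0r.
by rewrite addr0.
Qed.

Lemma coef_fpsXM p n : fps_coef (fpsX * p) n = if n is n'.+1 then p n' else 0.
Proof.
rewrite coef_fpsM; case: n => [|n]; first by rewrite big_ord1 /= mul0r.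
rewrite 2!big_ord_recl /= mul0r add0r mul1r big1 => [|i _]; last by rewrite mul0r.
by rewrite addr0 subn1.
Qed.

Lemma coef_fpsXnM m p n :
  fps_coef (fpsX ^+ m * p) n = if (m <= n)%N then p (n - m)%N else 0.
Proof.
elim: m n => [|m IH] n; first by rewrite expr0 mul1r subn0.
by rewrite exprS -mulrA coef_fpsXM; case: n => [//|n]; rewrite IH ltnS subSS.
Qed.

Lemma coef_fpsXn m n : fps_coef (fpsX ^+ m) n = (n == m)%:R :> R.
Proof.
rewrite -[_ ^+ m]mulr1 coef_fpsXnM /= subn_eq0 [n == m]eqn_leq andbC.
by case: (m <= n)%N => //=; case: ifP.
Qed.

Lemma fps_X_factor p : p 0%N = 0 ->
  exists2 v : {fps R}, p = fpsX * v & v 0%N = p 1%N.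
Proof.
move=> p0; exists (Fps (fun n => p n.+1)) => //.
by apply/fpsP => n; rewrite coef_fpsXM; case: n.
Qed.

Lemma coef_fps_exp_lt u k n : u 0%N = 0 -> (n < k)%N -> fps_coef (u ^+ k) n = 0.
Proof.
by move=> /fps_X_factor[v -> _] nk; rewrite exprMn coef_fpsXnM leqNgt nk.
Qed.

Lemma coef_fpsM_exp_lt p u k n :
  u 0%N = 0 -> (n < k)%N -> fps_coef (p * u ^+ k) n = 0.
Proof.
move=> u0 nk; rewrite mulrC coef_fpsM big1 // => i _.
by rewrite coef_fps_exp_lt ?mul0r // (leq_ltn_trans _ nk) // -ltnS.
Qed.

Fact fpsC_is_zmod_morphism : zmod_morphism (@fpsC R).
Proof. by move=> c d; apply/fpsP => -[|n] //=; rewrite subr0. Qed.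

Fact fpsC_is_monoid_morphism : monoid_morphism (@fpsC R).
Proof.
split=> // c d; apply/fpsP => n; rewrite coef_fpsCM /=.
by case: eqP => // _; rewrite mulr0.
Qed.

HB.instance Definition _ :=
  GRing.isZmodMorphism.Build R {fps R} (@fpsC R) fpsC_is_zmod_morphism.
HB.instance Definition _ :=
  GRing.isMonoidMorphism.Build R {fps R} (@fpsC R) fpsC_is_monoid_morphism.

End FpsCoefficients.

(** * Substitution of a series with zero constant term *)

Section FpsComposition.
Variables (R : comNzRingType) (u : {fps R}).
Hypothesis u0 : u 0%N = 0.
Implicit Types (p q : {fps R}) (P : {poly R}).

Lemma coef_fps_comp_wide p n N : (n < N)%N ->
  fps_comp p u n = \sum_(k < N) p k * fps_coef (u ^+ k) n.
Proof.
move=> nN; rewrite [LHS](big_ord_widen N (fun k => p k * fps_coef (u ^+ k) n)) //.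
rewrite big_mkcond; apply: eq_bigr => k _; case: ltnP => // nk.
by rewrite coef_fps_exp_lt // mulr0.
Qed.

(** Coefficient [n] of [p(u)] involves only [p 0], ..., [p n], because [u ^+ k] has no term of
    degree below [k]. Composition thus reduces to polynomial evaluation. *)
Lemma coef_fps_comp_poly p P n : (forall k, (k <= n)%N -> P`_k = p k) ->
  fps_comp p u n = fps_coef (map_poly (@fpsC R) P).[u] n.
Proof.
move=> Pp; set Q := map_poly _ _; set N := maxn n.+1 (size Q).
have nN : (n < N)%N by rewrite leq_maxl.
rewrite (coef_fps_comp_wide _ nN) (@horner_coef_wide _ N) ?leq_maxr //.
rewrite coef_fps_sum; apply: eq_bigr => k _; rewrite coef_map coef_fpsCM.
by case: (leqP k n) => [/Pp-> //|nk]; rewrite coef_fps_exp_lt ?mulr0.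
Qed.

(** The product of the truncations of [p] and [q] agrees with [p * q] up to degree [n], and
    polynomial evaluation is multiplicative. *)
Lemma fps_compM p q : fps_comp (p * q) u = fps_comp p u * fps_comp q u.
Proof.
apply/fpsP => n; pose tr p := \poly_(i < n.+1) (p : {fps R}) i.
have trE r k : (k <= n)%N -> (tr r)`_k = r k by rewrite coef_poly ltnS => ->.
rewrite (@coef_fps_comp_poly _ (tr p * tr q)) => [|k kn]; last first.
  rewrite coefM coef_fpsM; apply: eq_bigr => i _.
  by rewrite !trE // ?(leq_trans (leq_subr _ _)) // (leq_trans _ kn) // -ltnS.
rewrite rmorphM hornerM !coef_fpsM; apply: eq_bigr => i _.
have le_in : (i <= n)%N by rewrite -ltnS.
rewrite (@coef_fps_comp_poly p (tr p)) => [|k ki]; last first.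
  by rewrite trE // (leq_trans ki).
rewrite (@coef_fps_comp_poly q (tr q)) // => k ki.
by rewrite trE // (leq_trans ki) // leq_subr.
Qed.

(* Taking the proof of u 0 = 0 as an argument makes substitution a canonical ring
   morphism; for arbitrary u, fps_comp is not multiplicative. *)
Definition fps_subst (u0 : u 0%N = 0) p := fps_comp p u.

Fact fps_subst_is_zmod_morphism : zmod_morphism (fps_subst u0).
Proof.
move=> p q; apply/fpsP => n /=; rewrite -sumrB.
by apply: eq_bigr => k _; rewrite mulrBl.
Qed.

Lemma fps_compC c : fps_comp (fpsC c) u = fpsC c.
Proof.
apply/fpsP => n /=; rewrite big_ord_recl big1 => [|k _]; last by rewrite mul0r.
by rewrite addr0 expr0 /=; case: eqP => _; rewrite ?mulr1 ?mulr0.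
Qed.

Fact fps_subst_is_monoid_morphism : monoid_morphism (fps_subst u0).
Proof. by split; [exact: fps_compC | exact: fps_compM]. Qed.

HB.instance Definition _ := GRing.isZmodMorphism.Build {fps R} {fps R}
  (fps_subst u0) fps_subst_is_zmod_morphism.
HB.instance Definition _ := GRing.isMonoidMorphism.Build {fps R} {fps R}
  (fps_subst u0) fps_subst_is_monoid_morphism.

Lemma fps_compXn p k : fps_comp (p ^+ k) u = fps_comp p u ^+ k.
Proof. exact: (rmorphXn (fps_subst u0)). Qed.

Lemma fps_compD p q : fps_comp (p + q) u = fps_comp p u + fps_comp q u.
Proof. exact: (rmorphD (fps_subst u0)). Qed.

Lemma fps_comp_prod (I : Type) (r : seq I) (S : pred I) (F : I -> {fps R}) :
  fps_comp (\prod_(i <- r | S i) F i) u = \prod_(i <- r | S i) fps_comp (F i) u.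
Proof. exact: (rmorph_prod (fps_subst u0)). Qed.

Lemma fps_compX : fps_comp fpsX u = u.
Proof.
apply/fpsP => -[|n]; first by rewrite /= big_ord1 mul0r u0.
rewrite /= 2!big_ord_recl /= mul0r add0r mul1r big1 ?addr0 //.
by move=> k _; rewrite mul0r.
Qed.

Lemma coef0_fps_comp p : fps_comp p u 0%N = p 0%N.
Proof. by rewrite /= big_ord1 expr0 mulr1. Qed.

Lemma coef1_fps_comp p : fps_comp p u 1%N = p 1%N * u 1%N.
Proof. by rewrite /= big_ord_recl big_ord1 expr0 expr1 mulr0 add0r. Qed.

(** With a column series for [q], [F] for [u] and an A- or Z-sequence for [p], the right side is the
    sum in the recurrence. *)
Lemma coef_fpsM_comp p q n :
  fps_coef (q * fps_comp p u) n = \sum_(k < n.+1) p k * fps_coef (q * u ^+ k) n.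
Proof.
rewrite coef_fpsM.
under eq_bigr => i _ do
  rewrite (@coef_fps_comp_wide _ _ n.+1) ?ltnS ?leq_subr // big_distrr /=.
rewrite exchange_big; apply: eq_bigr => k _.
by rewrite coef_fpsM big_distrr; apply: eq_bigr => i _; rewrite mulrCA.
Qed.

End FpsComposition.

(** Up to degree [n], [p(u)] agrees with the finite sum [s], over which the substitution of [v]
    distributes. *)
Lemma fps_comp_assoc (R : comNzRingType) (p u v : {fps R}) :
  u 0%N = 0 -> v 0%N = 0 ->
  fps_comp (fps_comp p u) v = fps_comp p (fps_comp u v).
Proof.
move=> u0 v0; apply/fpsP => n.
pose s := \sum_(k < n.+1) fpsC (p k) * u ^+ k.
have -> : fps_comp (fps_comp p u) v n = fps_comp s v n.
  apply: eq_bigr => i _; congr (_ * _).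
  rewrite coef_fps_sum (coef_fps_comp_wide u0 _ (ltn_ord i)).
  by apply: eq_bigr => k _; rewrite coef_fpsCM.
rewrite [fps_comp s v](rmorph_sum (fps_subst v0)) coef_fps_sum.
apply: eq_bigr => k _.
rewrite -coef_fpsCM; congr (fps_coef _ n).
by rewrite [LHS]fps_compM // fps_compXn // fps_compC.
Qed.

Lemma gen_fun_comp (R : comNzRingType) l (a : nat -> R) : (0 < l)%N ->
  gen_fun l a = fps_comp (Fps a) (fpsX ^+ l).
Proof.
move=> l_gt0; apply/fpsP => n /=.
under eq_bigr => k _ do rewrite -exprM coef_fpsXn.
case: ifPn => [|ndvd]; last first.
  rewrite big1 // => k _; case: eqP => [nE|_]; last by rewrite mulr0.
  by rewrite nE dvdn_mulr in ndvd.
move=> /dvdnP[q]; rewrite mulnC => ->; rewrite mulKn //.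
have qP : (q < (l * q).+1)%N by rewrite ltnS leq_pmull.
rewrite (bigD1 (Ordinal qP)) //= eqxx mulr1 big1 ?addr0 // => k kq.
rewrite eqn_pmul2l //; case: eqP => [qE|_]; last by rewrite mulr0.
by case/eqP: kq; apply/val_inj.
Qed.

(** * Change of the coefficient ring *)

Section MapFps.
Variables (R S : comNzRingType) (iota : {rmorphism R -> S}).
Implicit Types p q : {fps R}.

Fact map_fps_is_zmod_morphism : zmod_morphism (map_fps iota).
Proof. by move=> p q; apply/fpsP => n /=; rewrite rmorphB. Qed.

Fact map_fps_is_monoid_morphism : monoid_morphism (map_fps iota).
Proof.
split=> [|p q]; apply/fpsP => n /=; first by case: eqP; rewrite ?rmorph1 ?rmorph0.
by rewrite rmorph_sum; apply: eq_bigr => i _; rewrite rmorphM.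
Qed.

HB.instance Definition _ := GRing.isZmodMorphism.Build {fps R} {fps S}
  (map_fps iota) map_fps_is_zmod_morphism.
HB.instance Definition _ := GRing.isMonoidMorphism.Build {fps R} {fps S}
  (map_fps iota) map_fps_is_monoid_morphism.

Lemma map_fpsC c : map_fps iota (fpsC c) = fpsC (iota c).
Proof. by apply/fpsP => n /=; case: eqP; rewrite ?rmorph0. Qed.

Lemma map_fpsX : map_fps iota fpsX = fpsX.
Proof. by apply/fpsP => n /=; rewrite rmorph_nat. Qed.

Lemma map_fps_comp p u :
  map_fps iota (fps_comp p u) = fps_comp (map_fps iota p) (map_fps iota u).
Proof.
apply/fpsP => n /=; rewrite rmorph_sum; apply: eq_bigr => k _.
by rewrite rmorphM -rmorphXn.
Qed.

Lemma map_gen_fun l (a : nat -> R) :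
  map_fps iota (gen_fun l a) = gen_fun l (iota \o a).
Proof. by apply/fpsP => n /=; case: ifP; rewrite ?rmorph0. Qed.

End MapFps.

Lemma fsum_nat_ord (V : nmodType) (F : nat -> V) N :
  (forall k, (N <= k)%N -> F k = 0) ->
  \sum_(k \in [set: nat]) F k = \sum_(k < N) F k.
Proof.
move=> F0; rewrite fsbig_ord; apply/esym/fsbig_widen => //= k [_ /=].
by move=> /negP; rewrite -leqNgt; exact: F0.
Qed.

(** * Column generating functions and the recurrences *)

Section MultipleRiordanColumns.
Variables (K : fieldType) (l : nat) (g : {fps K}) (f : 'I_l -> {fps K}).
Hypotheses (l_gt0 : (0 < l)%N) (hgf : is_multiple_riordan g f).

Let F := \prod_(i < l) f i.
(** Generates column [m] for [m <= l]; at [m = l] it is [g * F]. *)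
Definition riordan_col m := g * \prod_(i < l | (i < m)%N) f i.

Lemma riordan_f0 i : f i 0%N = 0.
Proof. by case: hgf => _ _ /(_ i)[[u _ ->] _]; rewrite coef_fpsM0 mul0r. Qed.

Lemma riordan_F0 : F 0%N = 0.
Proof.
by rewrite /F (bigD1 (Ordinal l_gt0)) //= big_ord1 riordan_f0 mul0r.
Qed.

(** As [m < l], the exponent of [f i] in column [m + j * l] is [j + 1] if [i < m] and [j]
    otherwise. *)
Lemma riordan_entryE n m j : (m < l)%N ->
  riordan_entry g f n (m + j * l) = fps_coef (riordan_col m * F ^+ j) n.
Proof.
move=> ml; congr (fps_coef _ n); rewrite -mulrA; congr (_ * _).
rewrite -prodrXl [in RHS]big_mkcond -big_split; apply: eq_bigr => i _ /=.
have -> : ((m + j * l + l - i.+1) %/ l = (i < m) + j)%N.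
  have -> : (m + j * l + l - i.+1 = j * l + (m + (l - i.+1)))%N.
    by rewrite -(addnBA _ (ltn_ord i)) [(m + _)%N]addnC -addnA.
  rewrite divnMDl // addnC; congr (_ + _)%N; case: ltnP => im.
    rewrite (addnBCA _ (ltn_ord i)) // divnDl // divnn l_gt0 divn_small //.
    by rewrite (leq_ltn_trans (leq_subr _ _)).
  by rewrite divn_small // addnC -ltn_subRL subKn.
by rewrite exprD; case: (i < m)%N; rewrite ?expr1 ?expr0.
Qed.

Lemma riordan_col_lowest m : (m <= l)%N ->
  exists2 v : {fps K}, riordan_col m = fpsX ^+ m * v
     & v 0%N = g 0%N * \prod_(i < l | (i < m)%N) f i 1%N.
Proof.
move=> ml.
have /choice[v fE] i : exists v : {fps K}, f i = fpsX * v /\ v 0%N = f i 1%N.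
  by have [v ? ?] := fps_X_factor (riordan_f0 i); exists v.
exists (g * \prod_(i < l | (i < m)%N) v i); last first.
  rewrite coef_fpsM0; congr (_ * _).
  rewrite (big_morph (fun p : {fps K} => p 0%N) (@coef_fpsM0 K) (erefl _)).
  by apply: eq_bigr => i _; case: (fE i).
rewrite mulrCA; congr (_ * _).
rewrite (eq_bigr (fun i => fpsX * v i)) => [|i _]; last by case: (fE i).
rewrite big_split prodr_const; congr (_ ^+ _ * _).
(* Since [m <= l], exactly [m] indices satisfy [i < m], each contributing one factor [fpsX]. *)
by rewrite -sum1_card -(big_ord_widen _ (fun=> 1%N) ml) sum1_card card_ord.
Qed.

(** Column [l] alone suffices: it is generated by [g * F], its recurrence involves the columns
    [g * F ^+ k], and [g] cancels. *)
Lemma A_sequence_eq a : is_A_sequence l (riordan_entry g f) a ->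
  F = fpsX ^+ l * fps_comp (Fps a) F.
Proof.
move=> ha; have g_neq0 : g != 0.
  by case: hgf => _ + _; apply: contraNneq => ->.
apply: (mulfI g_neq0); rewrite mulrCA; apply/fpsP => n; rewrite coef_fpsXnM.
have col0 : riordan_col 0 = g by rewrite /riordan_col big_pred0_eq mulr1.
rewrite -{1}col0 -[F]expr1.
have coll : riordan_col 0 * F ^+ 1 = riordan_col l.
  by rewrite col0 expr1; congr (_ * _); apply: eq_bigl => i; rewrite ltn_ord.
(* The recurrence does not reach rows [n < l]; there both sides vanish, since [g * F] is divisible
   by [fpsX ^+ l]. *)
case: leqP => [ln|nl]; last first.
  rewrite coll; have [v -> _] := riordan_col_lowest (leqnn l).
  by rewrite coef_fpsXnM leqNgt nl.
rewrite -riordan_entryE // add0n mul1n.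
(* For [k > n - l] the entry in row [n - l] vanishes, [F ^+ k] having no term of degree below [k];
   this is also the range in [coef_fpsM_comp]. *)
rewrite ha // (@fsum_nat_ord _ _ (n - l).+1) => [|k nk]; last first.
  rewrite addnC addnK -[(k * l)%N]add0n riordan_entryE //.
  by rewrite coef_fpsM_exp_lt ?mulr0 ?riordan_F0.
rewrite expr1 coef_fpsM_comp ?riordan_F0 //; apply: eq_bigr => k _.
by rewrite addnC addnK -[(k * l)%N]add0n riordan_entryE // col0.
Qed.

(** The recurrence starts at row [m + 1], so the diagonal entry in row [m] has to be added as a
    separate monomial. *)
Lemma Z_sequence_eq m z : (m < l)%N -> is_Z_sequence l (riordan_entry g f) m z ->
  riordan_col m =
    fpsC (g 0%N * \prod_(i < l | (i < m)%N) f i 1%N) * fpsX ^+ m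
    + fpsX ^+ l * (riordan_col m * fps_comp (Fps z) F).
Proof.
move=> ml hz; have [v colE v0] := riordan_col_lowest (ltnW ml).
apply/fpsP => n.
have -> (p q : {fps K}) : fps_coef (p + q) n = p n + q n by [].
rewrite coef_fpsCM coef_fpsXn coef_fpsXnM.
case: (ltngtP n m) => [nm|mn|->].
- rewrite leqNgt (ltn_trans nm ml) mulr0 addr0.
  by rewrite colE coef_fpsXnM leqNgt nm.
- rewrite mulr0 add0r; have := riordan_entryE n 0 ml.
  rewrite addn0 expr0 mulr1 => <-; rewrite hz // /entry_up.
  (* For [m < n < l] every [entry_up] is 0, so the recurrence itself forces the entry to vanish. *)
  case: leqP => [ln|nl]; last first.
    rewrite (@fsum_nat_ord _ _ 0) ?big_ord0 // => k _; exact: mulr0.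
  rewrite (@fsum_nat_ord _ _ (n - l).+1) => [|k nk]; last first.
    by rewrite riordan_entryE // coef_fpsM_exp_lt ?mulr0 ?riordan_F0.
  rewrite coef_fpsM_comp ?riordan_F0 //; apply: eq_bigr => k _.
  by rewrite riordan_entryE.
- by rewrite leqNgt ml mulr1 addr0 colE coef_fpsXnM leqnn subnn v0.
Qed.

End MultipleRiordanColumns.

(** The field [L] provides the coefficients of [h]. Quotients live in the fraction field because
    [hbar ^+ l] has zero constant term and is not a unit of [{fps L}]. *)
Theorem theorem4p1 (K : fieldType) (charK0 : [pchar K] =i pred0)
    (l : nat) (hl : (2 <= l)%N)
    (g : {fps K}) (f : 'I_l -> {fps K}) (hgf : is_multiple_riordan g f)
    (a : nat -> K) (ha : is_A_sequence l (riordan_entry g f) a)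
    (z : nat -> nat -> K)
    (hz : forall m, (m < l)%N -> is_Z_sequence l (riordan_entry g f) m (z m))
    (L : fieldType) (iota : {rmorphism K -> L})
    (h hbar : {fps L})
    (hh : h ^+ l = map_fps iota (\prod_(i < l) f i))
    (hhbar : comp_inverse h hbar) :
  let A : {fps L} := map_fps iota (gen_fun l a) in
  let Z m : {fps L} := map_fps iota (gen_fun l (z m)) in
  let g_hbar : {fps L} := fps_comp (map_fps iota g) hbar in
  let f_hbar i : {fps L} := fps_comp (map_fps iota (f i)) hbar in
  [/\ A%:F = (fpsX ^+ l)%:F / (hbar ^+ l)%:F,
      (Z 0%N)%:F =
        1 / (hbar ^+ l)%:F * (1 - (fpsC (iota (g 0%N)))%:F / g_hbar%:F)
    & forall m, (1 <= m < l)%N ->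
        (Z m)%:F =
          1 / (hbar ^+ l)%:F *
          (1 - (fpsC (iota (g 0%N * \prod_(i < l | (i < m)%N) f i 1%N))
                * hbar ^+ m)%:F
               / (g_hbar * \prod_(i < l | (i < m)%N) f_hbar i)%:F)].
Proof.
move=> A Z g_hbar f_hbar; case: hhbar => h0 hbar0 h_hbar _.
have l_gt0 : (0 < l)%N by exact: ltnW.
(* The substitution of [hbar] after extension of scalars, a ring morphism applied below to both
   column identities. *)
pose phi (p : {fps K}) := fps_comp (map_fps iota p) hbar.
have phiD p q : phi (p + q) = phi p + phi q by rewrite /phi rmorphD fps_compD.
have phiM p q : phi (p * q) = phi p * phi q by rewrite /phi rmorphM fps_compM.
have phiC c : phi (fpsC c) = fpsC (iota c) by rewrite /phi map_fpsC fps_compC.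
have phiXn n : phi (fpsX ^+ n) = hbar ^+ n.
  by rewrite /phi rmorphXn /= map_fpsX fps_compXn // fps_compX.
pose F := \prod_(i < l) f i.
have F0 : map_fps iota F 0%N = 0 by rewrite /= (riordan_F0 l_gt0 hgf) rmorph0.
have phiF : phi F = fpsX ^+ l by rewrite /phi -hh fps_compXn // h_hbar.
have phi_gen b : phi (fps_comp (Fps b) F) = map_fps iota (gen_fun l b).
  rewrite /phi map_fps_comp fps_comp_assoc // -/(phi F) phiF map_gen_fun.
  by rewrite gen_fun_comp.
(* The coefficient of [t] in [h(hbar) = t] gives [h 1 * hbar 1 = 1]. With [f i 1 != 0] this also
   makes every [f_hbar i] nonzero. *)
have hbar1 : hbar 1%N != 0.
  have /fpsP/(_ 1%N) := h_hbar; rewrite coef1_fps_comp /= => /eqP.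
  by apply: contraTneq => ->; rewrite mulr0 eq_sym oner_eq0.
have hbar_neq0 : hbar ^+ l != 0.
  by rewrite expf_neq0 //; apply: contraNneq hbar1 => ->.
have g_hbar_neq0 : g_hbar != 0.
  case: hgf => _ g0 _; apply: contraNneq g0 => /fpsP/(_ 0%N)/eqP.
  by rewrite coef0_fps_comp /= fmorph_eq0.
have f_hbar_neq0 i : f_hbar i != 0.
  case: hgf => _ _ /(_ i)[_ f1]; apply: contraNneq f1 => /fpsP/(_ 1%N)/eqP.
  by rewrite coef1_fps_comp /= mulf_eq0 (negPf hbar1) orbF fmorph_eq0.
pose G m := g_hbar * \prod_(i < l | (i < m)%N) f_hbar i.
have G_neq0 m : G m != 0.
  by rewrite mulf_neq0 //; apply/prodf_neq0 => i _.
(* One formula covers all [m < l]; at [m = 0] the products are empty. *)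
have ZE m : (m < l)%N ->
    (Z m)%:F = 1 / (hbar ^+ l)%:F *
      (1 - (fpsC (iota (g 0%N * \prod_(i < l | (i < m)%N) f i 1%N))
            * hbar ^+ m)%:F / (G m)%:F).
  move=> ml; have colE : phi (riordan_col g f m) = G m.
    by rewrite phiM /phi rmorph_prod fps_comp_prod.
  move: (Z_sequence_eq l_gt0 hgf ml (hz m ml)) colE.
  move: (riordan_col g f m) => col /(congr1 phi) + colE.
  rewrite phiD !phiM phi_gen colE phiC !phiXn; set c := fpsC _ => GE.
  (* [GE] reads [G m = c * hbar ^+ m + hbar ^+ l * (G m * Z m)]; it is solved for [Z m * hbar ^+ l]
     by cancelling [G m]. *)
  have ZhE : (Z m)%:F * (hbar ^+ l)%:F = 1 - (c * hbar ^+ m)%:F / (G m)%:F.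
    apply: (@mulIf _ (G m)%:F); first by rewrite tofrac_eq0.
    rewrite mulrBl mul1r divfK ?tofrac_eq0 // -!tofracM -tofracB; congr (_%:F).
    by rewrite [in RHS]GE addrC addKr [RHS]mulrCA [RHS]mulrC [Z m * _]mulrC.
  by rewrite -ZhE mul1r mulrC mulfK // tofrac_eq0.
split=> [||m /andP[_ ml]]; last exact: ZE.
(* The image of the identity for [F] is [fpsX ^+ l = hbar ^+ l * A]. *)
- have := congr1 phi (A_sequence_eq l_gt0 hgf ha).
  rewrite phiM phi_gen -/F phiF phiXn => ->.
  by rewrite tofracM mulrAC divff ?mul1r // tofrac_eq0.
- by rewrite ZE // /G !big_pred0_eq expr0 !mulr1.
Qed.
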